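(* Let $t\ge 1$ be an integer and $K$ a real constant. Let $G_N$ be a connected graph with a partition $V(G_N)=C\,\dot\cup\,X$, where $C$ induces a clique of order $N$ and $|X|=t$. Ordering the vertices of $C$ first and those of $X$ second, write $$A(G_N)=\begin{pmatrix}J_N-I_N&R\\R^{\mathsf T}&A_X\end{pmatrix}.$$ Assume that $\|R\|+\|A_X\|+\|R^{\mathsf T}\mathbf 1_C\|\le K$, where $K$ is independent of $N$, and set $b:=R^{\mathsf T}\mathbf 1_C$. Then, uniformly over all such $R$ and $A_X$, whenever $N\ge 5\max\{K,1\}+2$, $$\rho(G_N)=N-1+\frac{b^{\mathsf T}b}{N(N-1)}+\frac{b^{\mathsf T}A_Xb}{N(N-1)^2}+O_{t,K}(N^{-4}),$$ $$\rho(G_N)=N-1+\frac{b^{\mathsf T}b}{N(N-1)}+\frac{b^{\mathsf T}A_Xb}{N(N-1)^2}+\frac{b^{\mathsf T}A_X^2b}{N(N-1)^3}+\frac{b^{\mathsf T}R^{\mathsf T}\mathcal P_CRb}{N^2(N-1)^2}+O_{t,K}(N^{-5}),$$ where $\mathcal P_C:=I_N-\frac1N\mathbf 1_C\mathbf 1_C^{\mathsf T}$ is the orthogonal projection onto $\mathbf 1_C^{\perp}$. In particular, in these expansions the first correction term that may depend on the choice of $(R,A_X)$ is $\frac{b^{\mathsf T}b}{N(N-1)}$; and once $A_X$ and $b$ are fixed, the first quantity that may depend on the placement encoded by $R$ is $b^{\mathsf T}R^{\mathsf T}\mathcal P_CRb=\|\mathcal P_CRb\|^2$.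
   Context: Graphs are finite, simple and undirected; $A(G)$ is the adjacency matrix and $\rho(G)$ its spectral radius. $I_N$ and $J_N$ are the $N\times N$ identity and all-ones matrices, and $\mathbf 1_C$ is the all-ones column vector indexed by $C$. Thus $R$ is the $N\times t$ $0/1$ adjacency matrix between $C$ and $X$ (rows indexed by $C$), and $A_X$ is the adjacency matrix of the subgraph induced by $X$. Matrix norms are operator $2$-norms and vector norms are Euclidean. The notation $O_{t,K}(N^{-r})$, uniformly, means a remainder of absolute value at most $C_r N^{-r}$ with a constant $C_r$ depending only on $t$ and $K$ (not on $N$, $R$, $A_X$). *)

(* Defs.v *)
From HB Require Import structures.
From mathcomp Require Import all_boot all_order all_algebra.
From mathcomp Require Import all_classical all_reals complex.

Set Implicit Arguments.
Unset Strict Implicit.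
Unset Printing Implicit Defensive.

Import Order.TTheory GRing.Theory Num.Theory.
Local Open Scope ring_scope.

Section Norms.
Variable F : realType.

Definition dotv n (u v : 'cV[F]_n) : F := (u^T *m v) 0 0.

(* The library's norm on matrices is the max norm, so the Euclidean norm and
   the operator 2-norm are defined here. *)
Definition norm2 n (u : 'cV[F]_n) : F := Num.sqrt (\sum_i u i 0 ^+ 2).

Definition opnorm m n (A : 'M[F]_(m, n)) : F :=
  sup [set norm2 (A *m x) | x in [set x : 'cV[F]_n | norm2 x <= 1]]%classic.

(* Largest modulus of a complex eigenvalue; [eigenvalue] acts on row vectors,
   which has no effect on the spectrum. *)
Definition spectral_radius n (A : 'M[F]_n) : F :=
  sup [set Normc.normc z | z in
        [set z : F[i] | eigenvalue (map_mx (real_complex F) A) z]]%classic.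

End Norms.

Section Graphs.
Variables (V : finType).
Implicit Types (e : rel V) (C X : {set V}).

Definition simple_graph e := symmetric e /\ irreflexive e.

Definition connected_graph e := forall x y, connect e x y.

Definition is_clique e C := {in C &, forall x y, x != y -> e x y}.

Definition clique_split e C X (N t : nat) :=
  [/\ simple_graph e /\ connected_graph e,
      C :|: X = [set: V] /\ [disjoint C & X],
      is_clique e C, #|C| = N & #|X| = t].

Variable F : realType.

(* The 0/1 adjacency matrix between A and B, each listed in its [enum] order.
   With the vertices of C first and those of X second, the blocks of the
   adjacency matrix of the graph are [adjmx C C] = J - I, R = [adjmx C X],
   R^T and A_X = [adjmx X X]. *)
Definition adjmx e (A B : {set V}) : 'M[F]_(#|A|, #|B|) :=
  \matrix_(i, j) (e (enum_val i) (enum_val j))%:R.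

Definition rho e : F := spectral_radius (adjmx e [set: V] [set: V]).

Definition ones (C : {set V}) : 'cV[F]_#|C| := const_mx 1.

Definition projC (C : {set V}) : 'M[F]_#|C| :=
  1%:M - (#|C|%:R)^-1 *: (ones C *m (ones C)^T).

Definition degvec e C X : 'cV[F]_#|X| := (adjmx e C X)^T *m ones C.

(* The placement quantity b^T R^T P_C R b. *)
Definition placement e C X : F :=
  let R := adjmx e C X in
  let b := degvec e C X in
  dotv b (R^T *m projC C *m R *m b).

Definition admissible (K : F) (N t : nat) e C X :=
  clique_split e C X N t /\
  opnorm (adjmx e C X) + opnorm (adjmx e X X) + norm2 (degvec e C X) <= K.

End Graphs.

Definition large_order (F : realType) (K : F) (N : nat) :=
  5 * Num.max K 1 + 2 <= N%:R :> F.

Arguments adjmx {V} F e A B.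
Arguments rho {V} F e.
Arguments degvec {V} F e C X.
Arguments projC {V} F C.
Arguments placement {V} F e C X.

(* Main.v *)
Require Import Defs.
From HB Require Import structures.
From mathcomp Require Import all_boot all_order all_algebra.
From mathcomp Require Import all_classical all_reals complex.
From mathcomp Require Import ring lra spectral.

(**
Idea of the proof.  A(G) is real symmetric, so its spectral radius is the
modulus of a real eigenvalue lam with a real eigenvector, and it dominates every
Rayleigh quotient; the indicator vector of the clique gives N - 1 <= |lam|
([symmetric_spectral_radius], [rho_clique_split]).  Any eigenvalue this large in
modulus is pinned down by the equations below, which also exclude lam < 0.

Write the eigenvector as (u, x) along the partition, and let 1 be the all-ones
vector of the clique.  If 1^T u = 0 the remaining entries of the matrix are too
small to sustain an eigenvalue of size 5 max(K, 1) + 1; so one may scale to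
1^T u = 1.  Eliminating u leaves, with L = lam + 1 and b = R^T 1, a vector y
indexed by X such that
   L = N + b^T y   and   lam L y = b + R^T R y + L A_X y
([secular_vector]).  The second equation gives |y| = O(N^-2), whence lam > 0 and
lam = N - 1 + O(N^-2).  Pairing it with b, A_X b, A_X^2 b and R^T R b in turn
expands b^T y into
   b^T b p q + b^T A_X b p^2 q + b^T A_X^2 b p^3 q + |R b|^2 p^2 q^2 + O(N^-5)
with p = 1/lam and q = 1/L.  Replacing p by 1/(N-1) and q by 1/N costs O(N^-5),
because p and q move by O(N^-4) only; and replacing |R b|^2 by
b^T R^T P_C R b = |R b|^2 - (b^T b)^2 / N costs O(N^-5) as well
([truncation_error], [secular_expansion]).  All constants are explicit
polynomials in K ([rho_expansions]); comparing two graphs is then a triangle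
inequality.

That the two leading quantities really vary is seen on a clique with t pendant
vertices: adding a second edge to one of them changes b^T b, and moving one of
them to another clique vertex keeps b and A_X = 0 but changes |R b|^2.
*)

Set Implicit Arguments.
Unset Strict Implicit.
Unset Printing Implicit Defensive.

Import Order.TTheory GRing.Theory Num.Theory.
Local Open Scope ring_scope.

(** * Euclidean norm and operator norm *)

Section Euclidean.
Variable F : realType.

Lemma dotvE n (u v : 'cV[F]_n) : dotv u v = \sum_i u i 0 * v i 0.
Proof. by rewrite /dotv !mxE; apply: eq_bigr => i _; rewrite mxE. Qed.

Lemma dotvC n (u v : 'cV[F]_n) : dotv u v = dotv v u.
Proof. by rewrite !dotvE; apply: eq_bigr => i _; rewrite mulrC. Qed.

Lemma dotvDr n (u v w : 'cV[F]_n) : dotv u (v + w) = dotv u v + dotv u w.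
Proof. by rewrite /dotv mulmxDr mxE. Qed.

Lemma dotvZr n a (u v : 'cV[F]_n) : dotv u (a *: v) = a * dotv u v.
Proof. by rewrite /dotv -scalemxAr mxE. Qed.

Lemma dotv_adjoint m n (A : 'M[F]_(m, n)) u v :
  dotv u (A *m v) = dotv (A^T *m u) v.
Proof. by rewrite /dotv trmx_mul trmxK mulmxA. Qed.

Lemma norm2_ge0 n (u : 'cV[F]_n) : 0 <= norm2 u.
Proof. exact: sqrtr_ge0. Qed.

Lemma norm2_sqr n (u : 'cV[F]_n) : norm2 u ^+ 2 = dotv u u.
Proof.
rewrite /norm2 sqr_sqrtr; last by apply: sumr_ge0 => i _; exact: sqr_ge0.
by rewrite dotvE; apply: eq_bigr => i _; rewrite expr2.
Qed.

Lemma norm2_eq0 n (u : 'cV[F]_n) : norm2 u = 0 -> u = 0.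
Proof.
move=> u0; have : \sum_i u i 0 ^+ 2 == 0.
  under eq_bigr do rewrite expr2.
  by rewrite -dotvE -norm2_sqr u0 expr0n.
rewrite psumr_eq0 => [/allP h|i _]; last exact: sqr_ge0.
apply/matrixP => i j; rewrite ord1 mxE.
by have := h i (mem_index_enum _); rewrite sqrf_eq0 => /eqP.
Qed.

Lemma norm2_0 n : norm2 (0 : 'cV[F]_n) = 0.
Proof. by rewrite /norm2 big1 ?sqrtr0 // => i _; rewrite mxE expr0n. Qed.

Lemma norm2Z n a (u : 'cV[F]_n) : norm2 (a *: u) = `|a| * norm2 u.
Proof.
rewrite /norm2 -sqrtr_sqr -sqrtrM ?sqr_ge0 // mulr_sumr; congr Num.sqrt.
by apply: eq_bigr => i _; rewrite mxE exprMn.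
Qed.

Lemma cauchy_schwarz n (u v : 'cV[F]_n) : `|dotv u v| <= norm2 u * norm2 v.
Proof.
have [u0|u_neq0] := eqVneq (norm2 u) 0.
  by rewrite (norm2_eq0 u0) norm2_0 mul0r /dotv trmx0 mul0mx mxE normr0.
have a_gt0 : 0 < dotv u u by rewrite -norm2_sqr exprn_gt0 // lt_def u_neq0 norm2_ge0.
rewrite -ler_sqr ?nnegrE ?mulr_ge0 ?norm2_ge0 // real_normK ?num_real //.
rewrite exprMn !norm2_sqr.
(* Up to scaling, w is the component of v orthogonal to u. *)
pose w := dotv u u *: v + (- dotv u v) *: u.
have : 0 <= dotv w w by rewrite -norm2_sqr sqr_ge0.
have -> : dotv w w = dotv u u * (dotv u u * dotv v v - dotv u v ^+ 2).
  rewrite /w dotvDr !dotvZr (dotvC _ v) (dotvC _ u) !dotvDr !dotvZr (dotvC v u).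
  ring.
by rewrite pmulr_rge0 // subr_ge0.
Qed.

Lemma norm2D n (u v : 'cV[F]_n) : norm2 (u + v) <= norm2 u + norm2 v.
Proof.
rewrite -ler_sqr ?nnegrE ?addr_ge0 ?norm2_ge0 // norm2_sqr dotvDr !(dotvC (u + v)) !dotvDr.
have := le_trans (ler_norm _) (cauchy_schwarz u v).
rewrite sqrrD !norm2_sqr (dotvC v u); lra.
Qed.

(** The Frobenius norm: it shows that the supremum defining [opnorm] is taken over a
bounded set, and gives the bounds on concrete 0/1 matrices. *)
Definition frob m n (A : 'M[F]_(m, n)) : F := Num.sqrt (\sum_i \sum_j A i j ^+ 2).

Lemma norm2_frob m n (A : 'M[F]_(m, n)) x : norm2 (A *m x) <= frob A * norm2 x.
Proof.
rewrite /norm2 /frob -sqrtrM ?ler_wsqrtr //; last first.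
  by apply: sumr_ge0 => i _; apply: sumr_ge0 => j _; exact: sqr_ge0.
rewrite mulr_suml; apply: ler_sum => i _.
have -> : (A *m x) i 0 = dotv (row i A)^T x by rewrite /dotv trmxK -row_mul [RHS]mxE.
rewrite -real_normK ?num_real //.
apply: le_trans (_ : (norm2 (row i A)^T * norm2 x) ^+ 2 <= _).
  by rewrite ler_sqr ?nnegrE ?mulr_ge0 ?norm2_ge0 // cauchy_schwarz.
rewrite exprMn !norm2_sqr !dotvE.
rewrite (eq_bigr (fun j => A i j ^+ 2)) => [|j _]; last by rewrite !mxE.
by under [in leRHS]eq_bigr do rewrite expr2.
Qed.

Lemma opnorm_le_frob m n (A : 'M[F]_(m, n)) : opnorm A <= frob A.
Proof.
apply: ge_sup => [|_ [x /= x1 <-]].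
  by exists (norm2 (A *m 0)), 0 => //=; rewrite norm2_0.
apply: le_trans (norm2_frob _ _) _.
by rewrite ler_piMr // sqrtr_ge0.
Qed.

Lemma norm2_mulmx m n (A : 'M[F]_(m, n)) x :
  norm2 (A *m x) <= opnorm A * norm2 x.
Proof.
have [x0|x_neq0] := eqVneq (norm2 x) 0.
  by rewrite (norm2_eq0 x0) mulmx0 !norm2_0 mulr0.
have x_gt0 : 0 < norm2 x by rewrite lt_def x_neq0 norm2_ge0.
rewrite -ler_pdivrMr //; apply: ub_le_sup.
  exists (frob A) => _ [y /= y1 <-]; apply: le_trans (norm2_frob _ _) _.
  by rewrite ler_piMr // sqrtr_ge0.
exists ((norm2 x)^-1 *: x) => /=.
  rewrite norm2Z ger0_norm ?invr_ge0 ?norm2_ge0 //. rewrite mulVf //.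
by rewrite -scalemxAr norm2Z ger0_norm ?invr_ge0 ?norm2_ge0 // mulrC.
Qed.

Lemma opnorm_ge0 m n (A : 'M[F]_(m, n)) : 0 <= opnorm A.
Proof.
apply: ub_le_sup; last by exists 0 => /=; rewrite ?mulmx0 ?norm2_0.
exists (frob A) => _ [y /= y1 <-]; apply: le_trans (norm2_frob _ _) _.
by rewrite ler_piMr // sqrtr_ge0.
Qed.

(** A matrix and its transpose have the same operator norm; this half, from
|A^T x|^2 = x^T A (A^T x), is what the estimates need. *)
Lemma norm2_mul_trmx m n (A : 'M[F]_(m, n)) x :
  norm2 (A^T *m x) <= opnorm A * norm2 x.
Proof.
have [y0|y_neq0] := eqVneq (norm2 (A^T *m x)) 0.
  by rewrite y0 mulr_ge0 ?opnorm_ge0 ?norm2_ge0.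
have y_gt0 : 0 < norm2 (A^T *m x) by rewrite lt_def y_neq0 norm2_ge0.
rewrite -(ler_pM2l y_gt0) -expr2 norm2_sqr -dotv_adjoint mulrA.
apply: le_trans (ler_norm _) (le_trans (cauchy_schwarz _ _) _).
rewrite mulrC ler_wpM2r ?norm2_ge0 // mulrC; exact: norm2_mulmx.
Qed.

End Euclidean.

(** * Spectral radius of a real symmetric matrix *)

Section Spectrum.
Variable F : realType.
Local Open Scope sesquilinear_scope.
Local Notation toC := (real_complex F).

Lemma toC_real (x : F) : toC x \is Num.real.
Proof. by apply/complex_realP; exists x. Qed.

Lemma normc_real (x : F) : Normc.normc (toC x) = `|x|.
Proof. by rewrite /Normc.normc /= expr0n addr0 sqrtr_sqr. Qed.

Lemma normC_real (x : F) : `|toC x| = toC `|x|.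
Proof. by rewrite normc_def /= expr0n addr0 sqrtr_sqr. Qed.

(** Unitary diagonalisation over the complex numbers: the eigenvalues are the diagonal
entries, which are real, and the quadratic form of the matrix is a combination of
them with nonnegative weights.  A row of the unitary matrix is a complex
eigenvector, whose real or imaginary part is a nonzero real one. *)
Lemma symmetric_spectral_radius n (M : 'M[F]_n) : (0 < n)%N -> M^T = M ->
  exists lam : F, exists v : 'cV[F]_n,
    [/\ v != 0, M *m v = lam *: v, spectral_radius M = `|lam|
      & forall w, `|dotv w (M *m w)| <= `|lam| * dotv w w].
Proof.
move=> n_gt0 symM; pose Mc := map_mx toC M; set P := spectralmx Mc.
have hermM : Mc \is hermsymmx.
  apply: realsym_hermsym.
    by apply/is_hermitianmxP; rewrite expr0 scale1r map_mx_id // map_trmx symM.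
  by apply/mxOverP => i j; rewrite mxE; exact: toC_real.
pose d i := complex.Re (spectral_diag Mc 0 i).
have dE : spectral_diag Mc = \row_i toC (d i).
  apply/rowP => i; rewrite mxE RRe_real //.
  exact: (mxOverP (hermitian_spectral_diag_real hermM)).
have unitP : P \is unitarymx by apply: spectral_unitarymx.
have McE : Mc = P^t* *m diag_mx (\row_i toC (d i)) *m P.
  rewrite -dE -invmx_unitary //; apply/orthomx_spectralP; exact: hermitian_normalmx.
have PM : P *m Mc = diag_mx (\row_i toC (d i)) *m P.
  by rewrite {1}McE !mulmxA (unitarymxP unitP) mul1mx.
have [i0 _ max_d] := @arg_maxP _ _ _ (Ordinal n_gt0) xpredT (fun i => `|d i|) isT.
(* f stands for the real or the imaginary part. *)
have eig_part i (f : F[i] -> F) (f0 : f 0 = 0) (fD : {morph f : x y / x + y})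
    (fZ : forall (a : F) z, f (toC a * z) = a * f z) :
    M *m (\col_j f (P i j)) = d i *: \col_j f (P i j).
  apply/colP => j; rewrite !mxE -fZ.
  have -> : toC (d i) * P i j = (P *m Mc) i j by rewrite PM mul_diag_mx !mxE.
  rewrite mxE (big_morph f fD f0); apply: eq_bigr => k _.
  by rewrite !mxE -[M in LHS]symM mxE mulrC [in RHS]mulrC fZ mulrC.
have Pi0_neq0 : row i0 P != 0.
  apply/eqP => r0; have := congr1 (row i0) (unitarymxP unitP).
  rewrite row_mul r0 mul0mx => /rowP/(_ i0); rewrite !mxE eqxx => /esym/eqP.
  by rewrite oner_eq0.
have [v v_neq0 Mv] : exists2 v : 'cV[F]_n, v != 0 & M *m v = d i0 *: v.
  have ReZ (a : F) z : complex.Re (toC a * z) = a * complex.Re z.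
    by case: z => x y /=; rewrite mul0r subr0.
  have ImZ (a : F) z : complex.Im (toC a * z) = a * complex.Im z.
    by case: z => x y /=; rewrite mul0r addr0.
  have [vr|] := eqVneq (\col_j complex.Re (P i0 j)) 0; last first.
    by move=> ?; exists (\col_j complex.Re (P i0 j)) => //; apply: eig_part => // -[x y] [x' y'].
  have [vi|] := eqVneq (\col_j complex.Im (P i0 j)) 0; last first.
    by move=> ?; exists (\col_j complex.Im (P i0 j)) => //; apply: eig_part => // -[x y] [x' y'].
  case/negP: Pi0_neq0; apply/eqP/rowP => j; rewrite !mxE.
  move/colP/(_ j): vr; move/colP/(_ j): vi; rewrite !mxE.
  by case: (P i0 j) => x y /= -> ->.
(* The set of moduli has a maximum, so its supremum is that maximum. *)
pose S := [set Normc.normc z | z in [set z : F[i] | eigenvalue Mc z]]%classic.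
have S_max : S `|d i0|.
  exists (toC (d i0)); last exact: normc_real.
  apply/eigenvalueP; exists (row i0 P) => //.
  by rewrite -row_mul PM; apply/rowP => j; rewrite mxE mul_diag_mx !mxE.
have S_ub : ubound S `|d i0|.
  move=> _ [z /= /eigenvalueP[w wM w_neq0] <-].
  have y_neq0 : w *m P^t* != 0.
    by apply: contra w_neq0 => /eqP y0; rewrite -[w](mulmxKtV _ unitP) // y0 mul0mx.
  have yD : w *m P^t* *m diag_mx (\row_i toC (d i)) = z *: (w *m P^t*).
    by rewrite -[LHS](mulmxtVK _ unitP) -2!(mulmxA w) -McE wM scalemxAl.
  have /rV0Pn[j yj] := y_neq0.
  move/rowP/(_ j): yD; rewrite mul_mx_diag [LHS]mxE [RHS]mxE [X in _ * X]mxE mulrC.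
  by move/(mulIf yj) => <-; rewrite normc_real; exact: max_d.
exists (d i0), v; split=> //.
  apply/eqP; rewrite eq_le ge_sup //=; last by exists `|d i0|.
  by apply: ub_le_sup => //; exists `|d i0|.
(* y lists the coordinates of w in the orthonormal eigenbasis. *)
move=> w; pose wC : 'rV_n := map_mx toC w^T; pose y := wC *m P^t*.
have yt : y^t* = P *m wC^T.
  rewrite trmx_mul map_mxM map_trmx trmxK -map_mx_comp (map_mx_id (@conjCK _)); congr (_ *m _).
  by apply/colP => i; rewrite !mxE; exact/CrealP/toC_real.
have wMw : toC (dotv w (M *m w)) = \sum_i toC (d i) * `|y 0 i| ^+ 2.
  have -> : toC (dotv w (M *m w)) = (wC *m Mc *m wC^T) 0 0.
    by rewrite /dotv /wC /Mc map_trmx -!map_mxM trmxK mulmxA [RHS]mxE.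
  rewrite McE !mulmxA -/y -(mulmxA _ P) -yt mxE; apply: eq_bigr => i _.
  by rewrite mul_mx_diag !mxE mulrAC -normCK mulrC.
have ww : toC (dotv w w) = \sum_i `|y 0 i| ^+ 2.
  have -> : toC (dotv w w) = (wC *m wC^T) 0 0.
    by rewrite /dotv /wC map_trmx -!map_mxM trmxK [RHS]mxE.
  have -> : wC *m wC^T = y *m y^t*.
    by rewrite yt /y mulmxA -(mulmxA wC) (mulmx1C (unitarymxP unitP)) mulmx1.
  rewrite mxE.
  by apply: eq_bigr => i _; rewrite !mxE -normCK.
rewrite -lecR -normC_real wMw [leRHS]rmorphM /= ww.
apply: le_trans (ler_norm_sum _ _ _) _; rewrite mulr_sumr; apply: ler_sum => i _.
rewrite normrM normC_real [X in _ * X]ger0_norm ?exprn_ge0 // ler_wpM2r ?exprn_ge0 //.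
by rewrite lecR; exact: max_d.
Qed.
End Spectrum.

(** * Eliminating the clique from the eigenvalue equation *)

Section Secular.
Variable F : realType.

(** Here o plays the part of the all-ones vector: the first diagonal block is
o o^T - 1.  Were o^T u = 0, the two equations would read (lam + 1) u = R x and
lam x = R^T u + A x, and the size of lam forces both 4 |x| <= |u| and
5 |u| <= |x|, so the eigenvector would vanish.  Otherwise y = x / (o^T u); the
first equation paired with o is the scalar equation for lam, and substituting it in
lam + 1 times the second one eliminates u. *)
Lemma secular_vector m t (R : 'M[F]_(m, t)) (A : 'M[F]_t) (o u : 'cV[F]_m) (x : 'cV[F]_t)
    (k lam : F) :
  opnorm R <= k -> opnorm A <= k -> 5 * Num.max k 1 + 1 <= `|lam| ->
  (u != 0) || (x != 0) ->
  dotv o u *: o - u + R *m x = lam *: u -> R^T *m u + A *m x = lam *: x ->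
  exists y, lam + 1 = dotv o o + dotv (R^T *m o) y /\
    (lam * (lam + 1)) *: y = R^T *m o + R^T *m R *m y + (lam + 1) *: (A *m y).
Proof.
move=> Rk Ak; set M := Num.max k 1 => lamM ux_neq0 eqC eqX.
have [k_le_M M_ge1] : k <= M /\ 1 <= M by rewrite /M !le_max !lexx orbT.
have eqC' : (lam + 1) *: u = dotv o u *: o + R *m x.
  by rewrite scalerDl scale1r -eqC addrAC subrK.
have s_neq0 : dotv o u != 0.
  apply: contraL ux_neq0 => /eqP s0; move: eqC'; rewrite s0 scale0r add0r => eqC'.
  have hu := norm2_mulmx R x; rewrite -eqC' norm2Z in hu.
  have hx : `|lam| * norm2 x <= M * norm2 u + M * norm2 x.
    rewrite -norm2Z -eqX; apply: le_trans (norm2D _ _) (lerD _ _).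
      by apply: le_trans (norm2_mul_trmx _ _) _; rewrite ler_wpM2r ?norm2_ge0 ?(le_trans Rk).
    by apply: le_trans (norm2_mulmx _ _) _; rewrite ler_wpM2r ?norm2_ge0 ?(le_trans Ak).
  have hu' : `|lam + 1| * norm2 u <= M * norm2 x.
    by apply: le_trans hu _; rewrite ler_wpM2r ?norm2_ge0 ?(le_trans Rk).
  have L_ge : 5 * M <= `|lam + 1|.
    have := ler_normD (lam + 1) (-1); rewrite addrK normrN1; lra.
  have u_ge0 := norm2_ge0 u; have x_ge0 := norm2_ge0 x.
  (* Multiplying by M clears the factor M on the right of hx and hu'. *)
  have M_gt0 : 0 < M by lra.
  have hx4 : 4 * norm2 x <= norm2 u.
    rewrite -(ler_pM2l M_gt0); have := ler_wpM2r x_ge0 lamM; lra.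
  have hu5 : 5 * norm2 u <= norm2 x.
    rewrite -(ler_pM2l M_gt0); have := ler_wpM2r u_ge0 L_ge; lra.
  have u0 : norm2 u = 0 by apply/le_anti; lra.
  have x0 : norm2 x = 0 by apply/le_anti; lra.
  by rewrite (norm2_eq0 u0) (norm2_eq0 x0) !eqxx.
exists ((dotv o u)^-1 *: x); split.
  apply: (mulIf s_neq0); rewrite dotvZr [RHS]mulrDl mulrAC mulVf // mul1r.
  have /(congr1 (dotv o)) := eqC'; rewrite dotvDr !dotvZr dotv_adjoint => ->.
  by rewrite mulrC.
have LRu : (lam + 1) *: (R^T *m u) = dotv o u *: (R^T *m o) + R^T *m R *m x.
  by rewrite scalemxAr eqC' mulmxDr -scalemxAr mulmxA.
have eqx : (lam * (lam + 1)) *: x = dotv o u *: (R^T *m o) + R^T *m R *m x + (lam + 1) *: (A *m x).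
  by rewrite mulrC -scalerA -eqX scalerDr LRu.
rewrite scalerA mulrC -scalerA eqx !scalerDr scalerA mulVf // scale1r -!scalemxAr.
by rewrite !scalerA (mulrC _ (lam + 1)).
Qed.

(** The terms in y on the right are at most (1/25 + 1/5) |lam (lam + 1)| |y|, so they
can be absorbed on the left. *)
Lemma secular_norm m t (R : 'M[F]_(m, t)) (A : 'M[F]_t) (b y : 'cV[F]_t) (k lam : F) :
  opnorm R <= k -> opnorm A <= k -> norm2 b <= k -> 5 * Num.max k 1 + 1 <= `|lam| ->
  (lam * (lam + 1)) *: y = b + R^T *m R *m y + (lam + 1) *: (A *m y) ->
  `|lam * (lam + 1)| * norm2 y <= 2 * k.
Proof.
move=> Rk Ak bk; set M := Num.max k 1 => lamM eqy.
have [k_le_M M_ge1] : k <= M /\ 1 <= M by rewrite /M !le_max !lexx orbT.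
have k_ge0 : 0 <= k := le_trans (opnorm_ge0 R) Rk.
have L_ge : 5 * M <= `|lam + 1|.
  have := ler_normD (lam + 1) (-1); rewrite addrK normrN1; lra.
have y_ge0 := norm2_ge0 y.
have hB : norm2 (R^T *m R *m y) <= M * (M * norm2 y).
  rewrite -mulmxA; apply: le_trans (norm2_mul_trmx _ _) _.
  apply: ler_pM; rewrite ?opnorm_ge0 ?norm2_ge0 ?(le_trans Rk) //.
  apply: le_trans (norm2_mulmx _ _) _; rewrite ler_wpM2r ?(le_trans Rk) //.
have hA : norm2 ((lam + 1) *: (A *m y)) <= `|lam + 1| * (M * norm2 y).
  rewrite norm2Z ler_wpM2l //.
  apply: le_trans (norm2_mulmx _ _) _; rewrite ler_wpM2r ?(le_trans Ak) //.
have := congr1 (@norm2 F t) eqy; rewrite norm2Z => hy.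
have h1 := norm2D (b + R^T *m R *m y) ((lam + 1) *: (A *m y)).
have h2 := norm2D b (R^T *m R *m y).
rewrite -hy in h1.
have h3 : `|lam * (lam + 1)| * norm2 y <= k + M * (M * norm2 y) + `|lam + 1| * (M * norm2 y).
  lra.
move: h3; rewrite normrM.
set l := `|lam| in lamM *; set L := `|lam + 1| in L_ge *; set z := norm2 y in y_ge0 *.
move=> h3.
have M_ge0 : 0 <= M by lra.
have L_ge0 : 0 <= L by rewrite normr_ge0.
have e1 : (5 * M + 1) * (L * z) <= l * (L * z) by apply: ler_wpM2r => //; rewrite mulr_ge0.
have e2 : 5 * M * (M * z) <= L * (M * z) by apply: ler_wpM2r => //; rewrite mulr_ge0.
have Lz_ge0 : 0 <= L * z by rewrite mulr_ge0.
lra.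
Qed.

End Secular.

(** * The scalar expansion and its truncation error *)

Section Expansion.
Variable F : realType.

Lemma normM_le (a b x y : F) : `|a| <= x -> `|b| <= y -> `|a * b| <= x * y.
Proof. by move=> ax bY; rewrite normrM ler_pM. Qed.

Lemma normD_le (a b x y : F) : `|a| <= x -> `|b| <= y -> `|a + b| <= x + y.
Proof. by move=> ax bY; apply: le_trans (ler_normD _ _) (lerD _ _). Qed.

Lemma normM_sub_le (a b a0 b0 x y da db : F) :
  `|a0| <= x -> `|b| <= y -> `|a - a0| <= da -> `|b - b0| <= db ->
  `|a * b - a0 * b0| <= da * y + x * db.
Proof.
move=> ha hb hda hdb; have -> : a * b - a0 * b0 = (a - a0) * b + a0 * (b - b0) by ring.
by apply: normD_le; apply: normM_le.
Qed.

(** The scalar content of the expansion.  Here h and q0 stand for 1/(N-1) and 1/N, p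
and q for 1/lam and 1/(lam+1), and d for lam - (N-1).  A variable y_M stands for
the number b^T M y, where B means R^T R; the four equations result from pairing the
vector equation for y with b, A b, A^2 b and B b.  After substitution, each term
of the difference carries a factor h^5: either it is one of the remaining y_M, or
it compares p and q with h and q0, or it is the correction kappa - q0 beta^2 of
the coefficient kappa = |R b|^2. *)
Lemma truncation_error (k h q0 p q d beta alpha gamma kappa y_A y_B y_AA y_AB y_BA y_BB
    y_AAA y_BAA : F) :
  0 <= k -> 0 <= h <= 1 ->
  0 <= p <= h -> 0 <= q <= q0 -> q0 <= h ->
  h - p <= 2 * k ^+ 2 * h ^+ 4 -> q0 - q <= 2 * k ^+ 2 * h ^+ 4 ->
  d = p * q * beta + p * q * y_B + p * y_A ->
  y_A = p * q * alpha + p * q * y_BA + p * y_AA ->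
  y_AA = p * q * gamma + p * q * y_BAA + p * y_AAA ->
  y_B = p * q * kappa + p * q * y_BB + p * y_AB ->
  `|beta| <= k ^+ 2 -> `|alpha| <= k ^+ 3 -> `|gamma| <= k ^+ 4 -> `|kappa| <= k ^+ 4 ->
  `|y_BA| <= 2 * k ^+ 5 * h ^+ 2 -> `|y_AB| <= 2 * k ^+ 5 * h ^+ 2 ->
  `|y_AAA| <= 2 * k ^+ 5 * h ^+ 2 -> `|y_BAA| <= 2 * k ^+ 6 * h ^+ 2 ->
  `|y_BB| <= 2 * k ^+ 6 * h ^+ 2 ->
  `|d - (beta * (h * q0) + alpha * (h ^+ 2 * q0) + gamma * (h ^+ 3 * q0)
         + (kappa - q0 * beta ^+ 2) * (h ^+ 2 * q0 ^+ 2))|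
    <= (5 * k ^+ 4 + 12 * k ^+ 5 + 20 * k ^+ 6) * h ^+ 5.
Proof.
move=> k_ge0 /andP[h_ge0 h_le1] /andP[p_ge0 p_le] /andP[q_ge0 q_le] q0_le hp hq.
move=> -> -> -> -> hbeta halpha hgamma hkappa hBA hAB hAAA hBAA hBB.
set eta := 2 * k ^+ 2 * h ^+ 4 in hp hq.
have p_n : `|p| <= h by rewrite ger0_norm.
have q_n : `|q| <= h by rewrite ger0_norm // (le_trans q_le).
have h_n : `|h| <= h by rewrite ger0_norm.
have q0_n : `|q0| <= h by rewrite ger0_norm // (le_trans q_ge0).
have dp : `|p - h| <= eta by rewrite distrC ger0_norm // subr_ge0.
have dq : `|q - q0| <= eta by rewrite distrC ger0_norm // subr_ge0.
(* Bounds on p q - h q0, p^2 q - h^2 q0, p^3 q - h^3 q0 and (p q)^2 - (h q0)^2. *)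
have dpq := normM_sub_le h_n q_n dp dq.
have pq_n := normM_le p_n q_n.
have hq0_n := normM_le h_n q0_n.
have dppq := normM_sub_le h_n pq_n dp dpq.
have ppq_n := normM_le p_n pq_n.
have dpppq := normM_sub_le h_n ppq_n dp dppq.
have dpqpq := normM_sub_le hq0_n pq_n dpq dpq.
(* t1 to t4: replacing p and q; t5: replacing kappa; r1 to r5: the tails y_M. *)
have t1 := normM_le hbeta dpq.
have t2 := normM_le halpha dppq.
have t3 := normM_le hgamma dpppq.
have t4 := normM_le hkappa dpqpq.
have t5 := normM_le (normM_le hbeta hbeta) (normM_le q0_n (normM_le hq0_n hq0_n)).
have r1 := normM_le ppq_n hBA.
have r2 := normM_le (normM_le p_n ppq_n) hBAA.
have r3 := normM_le (normM_le p_n (normM_le p_n p_n)) hAAA.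
have r4 := normM_le (normM_le pq_n pq_n) hBB.
have r5 := normM_le (normM_le pq_n p_n) hAB.
set T1 := beta * _ in t1; set T2 := alpha * _ in t2; set T3 := gamma * _ in t3.
set T4 := kappa * _ in t4; set T5 := beta * beta * _ in t5.
set R1 := _ * y_BA in r1; set R2 := _ * y_BAA in r2; set R3 := _ * y_AAA in r3.
set R4 := _ * y_BB in r4; set R5 := _ * y_AB in r5.
rewrite [X in `|X|](_ : _ = T1 + T2 + T3 + T4 + T5 + R1 + R2 + R3 + R4 + R5); last first.
  by rewrite /T1 /T2 /T3 /T4 /T5 /R1 /R2 /R3 /R4 /R5; ring.
have := normD_le (normD_le (normD_le (normD_le (normD_le (normD_le (normD_le (normD_le
  (normD_le t1 t2) t3) t4) t5) r1) r2) r3) r4) r5.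
move=> /le_trans; apply.
have mono i j l : (l <= j)%N -> k ^+ i * h ^+ j <= k ^+ i * h ^+ l.
  by move=> lj; rewrite ler_wpM2l ?exprn_ge0 // ler_wiXn2l.
have := mono 5 6 5 isT; have := mono 6 6 5 isT; have := mono 6 7 5 isT.
rewrite /eta; lra.
Qed.
End Expansion.

(** * Expansion of a large eigenvalue *)

Section SecularExpansion.
Variable F : realType.

Definition proj_off m (o : 'cV[F]_m) : 'M[F]_m := 1%:M - (dotv o o)^-1 *: (o *m o^T).

Lemma proj_off_mul m (o z : 'cV[F]_m) :
  proj_off o *m z = z - ((dotv o o)^-1 * dotv o z) *: o.
Proof.
rewrite mulmxBl mul1mx -scalemxAl -mulmxA; congr (_ - _); rewrite -scalerA; congr (_ *: _).
by rewrite [o^T *m z]mx11_scalar mul_mx_scalar.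
Qed.

Lemma dotv_proj_off m (o z : 'cV[F]_m) :
  dotv z (proj_off o *m z) = dotv z z - (dotv o o)^-1 * dotv o z ^+ 2.
Proof. by rewrite proj_off_mul -scaleNr dotvDr dotvZr (dotvC z o); ring. Qed.

Lemma norm2_proj_off m (o z : 'cV[F]_m) : dotv o o != 0 ->
  norm2 (proj_off o *m z) ^+ 2 = dotv z (proj_off o *m z).
Proof.
move=> o_neq0; rewrite norm2_sqr {1}proj_off_mul.
set w := proj_off o *m z.
have ow : dotv o w = 0.
  by rewrite /w proj_off_mul -scaleNr dotvDr dotvZr; field.
by rewrite -scaleNr dotvC dotvDr dotvZr (dotvC w o) ow mulr0 addr0 dotvC.
Qed.

(** Since |o^T R y| <= 1, the scalar equation makes lam + 1 nearly n, hence positive. *)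
Lemma secular_root_ge m t (R : 'M[F]_(m, t)) (A : 'M[F]_t) (o : 'cV[F]_m) (y : 'cV[F]_t)
    (k lam : F) (b := R^T *m o) (n := dotv o o) :
  opnorm R <= k -> opnorm A <= k -> norm2 b <= k ->
  5 * Num.max k 1 + 2 <= n -> n - 1 <= `|lam| ->
  lam + 1 = n + dotv b y ->
  (lam * (lam + 1)) *: y = b + R^T *m R *m y + (lam + 1) *: (A *m y) ->
  n - 1 <= lam /\ `|lam| = lam.
Proof.
move=> Rk Ak bk; set M := Num.max k 1 => nM lam_ge eqL eqy.
have [k_le_M M_ge1] : k <= M /\ 1 <= M by rewrite /M !le_max !lexx orbT.
have k_ge0 : 0 <= k := le_trans (opnorm_ge0 R) Rk.
have lamM : 5 * M + 1 <= `|lam| by lra.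
have hy := secular_norm Rk Ak bk lamM eqy.
have L_ge : 5 * M <= `|lam + 1|.
  have := ler_normD (lam + 1) (-1); rewrite addrK normrN1; lra.
have y_ge0 := norm2_ge0 y.
have hby : `|dotv b y| <= M * norm2 y.
  apply: le_trans (cauchy_schwarz _ _) _; rewrite ler_wpM2r //; exact: le_trans bk _.
have lamL : 5 * M * (5 * M) <= `|lam * (lam + 1)|.
  rewrite normrM; apply: ler_pM => //; lra.
have M_gt0 : 0 < M by lra.
have small : M * norm2 y <= 1.
  rewrite -(ler_pM2l M_gt0); have := ler_wpM2r y_ge0 lamL.
  have := ler_wpM2r (ltW M_gt0) M_ge1; lra.
have lam_ge0 : 0 <= lam by move: hby; rewrite ler_norml => /andP[]; lra.
by rewrite ger0_norm // in lam_ge *.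
Qed.

(** The norms of all the vectors c paired with y are bounded by powers of k, and
|y| <= 2 k h^2; the hypotheses of [truncation_error] then follow.  In particular
lam - (n - 1) = b^T y <= 2 k^2 h^2, so the reciprocals of lam and lam + 1 differ
from those of n - 1 and n by at most 2 k^2 h^4. *)
Lemma secular_expansion m t (R : 'M[F]_(m, t)) (A : 'M[F]_t) (o : 'cV[F]_m) (y : 'cV[F]_t)
    (k lam : F) (b := R^T *m o) (n := dotv o o) (h := (n - 1)^-1) :
  A^T = A -> opnorm R <= k -> opnorm A <= k -> norm2 b <= k ->
  5 * Num.max k 1 + 2 <= n -> n - 1 <= `|lam| ->
  lam + 1 = n + dotv b y ->
  (lam * (lam + 1)) *: y = b + R^T *m R *m y + (lam + 1) *: (A *m y) ->
  `| `|lam| - (n - 1) - (dotv b b * (h * n^-1) + dotv b (A *m b) * (h ^+ 2 * n^-1)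
       + dotv b (A *m A *m b) * (h ^+ 3 * n^-1)
       + dotv b (R^T *m proj_off o *m R *m b) * (h ^+ 2 * n^-1 ^+ 2))|
    <= (5 * k ^+ 4 + 12 * k ^+ 5 + 20 * k ^+ 6) * h ^+ 5.
Proof.
move=> symA Rk Ak bk nM lam_ge' eqL eqy.
have [lam_ge ->] : n - 1 <= lam /\ `|lam| = lam.
  exact: (secular_root_ge Rk Ak bk nM lam_ge' eqL eqy).
have k_ge0 : 0 <= k := le_trans (opnorm_ge0 R) Rk.
have M_ge1 : 1 <= Num.max k 1 by rewrite le_max lexx orbT.
have lamM : 5 * Num.max k 1 + 1 <= `|lam| by lra.
have hy := secular_norm Rk Ak bk lamM eqy.
have n1_gt0 : 0 < n - 1 by lra.
have n_gt0 : 0 < n by lra.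
have lam_gt0 : 0 < lam by lra.
have L_gt0 : 0 < lam + 1 by lra.
set p := lam^-1; set q := (lam + 1)^-1.
have p_ge0 : 0 <= p by rewrite invr_ge0 ltW.
have q_ge0 : 0 <= q by rewrite invr_ge0 ltW.
have h_ge0 : 0 <= h by rewrite invr_ge0 ltW.
have nV_ge0 : 0 <= n^-1 by rewrite invr_ge0 ltW.
have p_le : p <= h by rewrite lef_pV2 ?posrE.
have nV_le : n^-1 <= h by rewrite lef_pV2 ?posrE //; lra.
have h_le1 : h <= 1 by rewrite invf_le1 //; lra.
(* The equation for y paired with c; A and R^T R are moved to c by symmetry. *)
have Yc c : dotv c y = p * q * dotv c b + p * q * dotv (R^T *m (R *m c)) y + p * dotv (A *m c) y.
  have := congr1 (dotv c) eqy; rewrite !dotvDr !dotvZr -(mulmxA R^T) !dotv_adjoint trmxK symA => e.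
  have -> : dotv c y = p * q * (lam * (lam + 1) * dotv c y).
    by rewrite /p /q; field; rewrite !gt_eqF.
  by rewrite e /p /q; field; rewrite !gt_eqF.
have norm_A c x : norm2 c <= x -> norm2 (A *m c) <= k * x.
  by move=> cx; apply: le_trans (norm2_mulmx _ _) (ler_pM _ _ _ _); rewrite ?opnorm_ge0 ?norm2_ge0.
have norm_R c x : norm2 c <= x -> norm2 (R^T *m (R *m c)) <= k ^+ 2 * x.
  move=> cx; apply: le_trans (norm2_mul_trmx _ _) _; rewrite expr2 -mulrA.
  apply: ler_pM; rewrite ?opnorm_ge0 ?norm2_ge0 //.
  by apply: le_trans (norm2_mulmx _ _) (ler_pM _ _ _ _); rewrite ?opnorm_ge0 ?norm2_ge0.
have y_le : norm2 y <= 2 * k * h ^+ 2.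
  have -> : norm2 y = `|lam * (lam + 1)| * norm2 y * (p * q).
    by rewrite gtr0_norm ?mulr_gt0 // /p /q; field; rewrite !gt_eqF.
  apply: ler_pM => //; rewrite ?mulr_ge0 ?norm2_ge0 // expr2; apply: ler_pM => //.
  by apply: le_trans nV_le; rewrite lef_pV2 ?posrE //; lra.
have Y_le c x : norm2 c <= x -> `|dotv c y| <= x * (2 * k * h ^+ 2).
  by move=> cx; apply: le_trans (cauchy_schwarz _ _) (ler_pM _ _ _ _); rewrite ?norm2_ge0.
have b_le c x : norm2 c <= x -> `|dotv c b| <= x * k.
  by move=> cx; apply: le_trans (cauchy_schwarz _ _) (ler_pM _ _ _ _); rewrite ?norm2_ge0.
have d_le : lam - (n - 1) <= 2 * k ^+ 2 * h ^+ 2.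
  have := ler_norm (dotv b y); have := Y_le _ _ bk; lra.
have inv_sub (x x0 : F) : n - 1 <= x0 -> x0 <= x -> x - x0 <= 2 * k ^+ 2 * h ^+ 2 ->
    x0^-1 - x^-1 <= 2 * k ^+ 2 * h ^+ 4.
  move=> x0_ge xx0 dx; have x0_gt0 : 0 < x0 by lra.
  have x_gt0 : 0 < x by lra.
  have -> : x0^-1 - x^-1 = (x - x0) * (x0^-1 * x^-1) by field; rewrite !gt_eqF.
  have -> : 2 * k ^+ 2 * h ^+ 4 = 2 * k ^+ 2 * h ^+ 2 * (h * h) by ring.
  have [x0V_ge0 xV_ge0] : 0 <= x0^-1 /\ 0 <= x^-1 by rewrite !invr_ge0 !ltW.
  apply: ler_pM; rewrite ?subr_ge0 ?mulr_ge0 //.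
  by apply: ler_pM; rewrite // lef_pV2 ?posrE //; lra.
(* b^T R^T P R b = |R b|^2 - (o^T R b)^2 / n, and o^T R b = b^T b. *)
have pi_E : dotv b (R^T *m proj_off o *m R *m b)
    = dotv (R^T *m (R *m b)) b - n^-1 * dotv b b ^+ 2.
  rewrite -!mulmxA [LHS]dotv_adjoint trmxK dotv_proj_off -/n.
  by rewrite [dotv (R *m b) _]dotv_adjoint [dotv o _]dotv_adjoint.
have nAb := norm_A _ _ bk; have nAAb := norm_A _ _ nAb; have nBb := norm_R _ _ bk.
rewrite pi_E.
apply: (@truncation_error _ k h n^-1 p q _ _ _ _ _ (dotv (A *m b) y) (dotv (R^T *m (R *m b)) y)
  (dotv (A *m (A *m b)) y) (dotv (A *m (R^T *m (R *m b))) y) (dotv (R^T *m (R *m (A *m b))) y)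
  (dotv (R^T *m (R *m (R^T *m (R *m b)))) y) (dotv (A *m (A *m (A *m b))) y)
  (dotv (R^T *m (R *m (A *m (A *m b)))) y)) => //.
- by rewrite h_ge0.
- by rewrite p_ge0.
- by rewrite q_ge0 lef_pV2 ?posrE //; lra.
- exact: inv_sub.
- by apply: inv_sub; lra.
- by rewrite -Yc; lra.
- by rewrite (dotvC b) -Yc.
- by rewrite -mulmxA (dotvC b) -Yc.
- by have := b_le _ _ bk; lra.
- by rewrite dotvC; have := b_le _ _ nAb; lra.
- by rewrite dotvC -mulmxA; have := b_le _ _ nAAb; lra.
- by have := b_le _ _ nBb; lra.
- by have := Y_le _ _ (norm_R _ _ nAb); lra.
- by have := Y_le _ _ (norm_A _ _ nBb); lra.
- by have := Y_le _ _ (norm_A _ _ nAAb); lra.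
- by have := Y_le _ _ (norm_R _ _ nAAb); lra.
- by have := Y_le _ _ (norm_R _ _ nBb); lra.
Qed.
End SecularExpansion.

(** * The adjacency matrix along a clique partition *)

Section CliqueSplit.
Variables (F : realType) (V : finType).
Implicit Types (e : rel V) (A B C X : {set V}).

Lemma tr_adjmx e A B : symmetric e -> (adjmx F e A B)^T = adjmx F e B A.
Proof. by move=> sym_e; apply/matrixP => i j; rewrite !mxE sym_e. Qed.

(** Block vectors are written as restrictions of a weighting of all vertices, so that
matrix products become sums over vertex sets, free of enumerations. *)
Definition restr (A : {set V}) (w : V -> F) : 'cV[F]_#|A| := \col_i w (enum_val i).

Lemma adjmx_restr e A B w :
  adjmx F e A B *m restr B w = restr A (fun a => \sum_(c in B) (e a c)%:R * w c).
Proof.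
apply/colP => i; rewrite !mxE [RHS]big_enum_val.
by apply: eq_bigr => j _; rewrite !mxE.
Qed.

Lemma dotv_restr A v w : dotv (restr A v) (restr A w) = \sum_(a in A) v a * w a.
Proof. by rewrite dotvE [RHS]big_enum_val; apply: eq_bigr => i _; rewrite !mxE. Qed.

Lemma ones_restr A : ones F A = restr A (fun=> 1).
Proof. by apply/colP => i; rewrite !mxE. Qed.

Lemma restr_setT (u : 'cV[F]_#|[set: V]|) : exists w, u = restr [set: V] w.
Proof.
exists (fun a => u (enum_rank_in (finset.in_setT a) a) 0).
by apply/colP => i; rewrite mxE enum_valK_in.
Qed.

(** The eigenvector of the whole adjacency matrix is cut into its two blocks; the
lower bound N - 1 is the Rayleigh quotient of the indicator vector of C. *)
Lemma rho_clique_split e C X N t : clique_split e C X N t -> (0 < N)%N ->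
  exists lam : F, exists u : 'cV[F]_#|C|, exists x : 'cV[F]_#|X|,
    let R := adjmx F e C X in
    [/\ (u != 0) || (x != 0), rho F e = `|lam|, N%:R - 1 <= `|lam|,
        dotv (ones F C) u *: ones F C - u + R *m x = lam *: u
      & R^T *m u + adjmx F e X X *m x = lam *: x].
Proof.
move=> [[[sym_e irr_e] _] [CX dCX] clique_C card_C card_X] N_gt0.
set M := adjmx F e [set: V] [set: V].
have V_gt0 : (0 < #|[set: V]|)%N.
  by apply: leq_trans (subset_leq_card (finset.subsetT C)); rewrite card_C.
have [lam [v [v_neq0 Mv rhoE ray]]] :=
  symmetric_spectral_radius V_gt0 (tr_adjmx _ _ sym_e : M^T = M).
have [w vE] := restr_setT v.
have splitV (f : V -> F) : \sum_(a in [set: V]) f a = \sum_(a in C) f a + \sum_(a in X) f a.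
  by rewrite -bigU //; apply: eq_bigl => a; rewrite -CX !inE.
have eqn a : \sum_(c in C) (e a c)%:R * w c + \sum_(c in X) (e a c)%:R * w c = lam * w a.
  have := Mv; rewrite vE adjmx_restr => /colP/(_ (enum_rank_in (finset.in_setT a) a)).
  by rewrite !mxE enum_rankK_in ?inE // splitV.
have sum_clique (f : V -> F) a : a \in C ->
    \sum_(c in C) (e a c)%:R * f c = \sum_(c in C) f c - f a.
  move=> aC; rewrite (bigD1 a) //= irr_e mul0r add0r [in RHS](bigD1 a) //= addrAC subrr add0r.
  by apply: eq_bigr => c /andP[cC ca]; rewrite clique_C 1?eq_sym // mul1r.
have degC a : a \in C -> \sum_(c in C) (e a c)%:R = N%:R - 1 :> F.
  move=> /(sum_clique (fun=> 1)); rewrite sumr_const card_C => <-.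
  by apply: eq_bigr => c _; rewrite mulr1.
exists lam, (restr C w), (restr X w); split=> //.
- rewrite -negb_and; apply: contra v_neq0 => /andP[/eqP/colP u0 /eqP/colP x0].
  rewrite vE; apply/eqP/colP => i; rewrite !mxE; set a := enum_val i.
  have : a \in C :|: X by rewrite CX inE.
  rewrite inE => /orP[aC|aX].
    by have := u0 (enum_rank_in aC a); rewrite !mxE enum_rankK_in.
  by have := x0 (enum_rank_in aX a); rewrite !mxE enum_rankK_in.
- have := ray (restr [set: V] (fun a => (a \in C)%:R)).
  have sumC (f : V -> F) : \sum_(a in [set: V]) (a \in C)%:R * f a = \sum_(a in C) f a.
    rewrite splitV [X in _ + X]big1 ?addr0 => [|a aX].
      by apply: eq_bigr => a ->; rewrite mul1r.
    by rewrite (disjointFl dCX aX) mul0r.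
  rewrite adjmx_restr !dotv_restr !sumC.
  have -> : \sum_(a in C) (a \in C)%:R = N%:R :> F.
    by rewrite -card_C -sum1_card natr_sum; apply: eq_bigr => a ->.
  under eq_bigr => a aC do (under eq_bigr => c _ do rewrite mulrC; rewrite sumC).
  have -> : \sum_(a in C) \sum_(c in C) (e a c)%:R = N%:R * (N%:R - 1) :> F.
    under eq_bigr => a aC do rewrite degC //.
    by rewrite sumr_const card_C -[LHS]mulr_natl.
  rewrite ger0_norm ?mulr_ge0 // ?subr_ge0 ?ler1n // mulrC.
  by rewrite ler_pM2r ?ltr0n.
- rewrite ones_restr dotv_restr adjmx_restr; apply/colP => i; rewrite !mxE.
  rewrite -eqn sum_clique ?enum_valP // mulr1; congr (_ - _ + _).
  by apply: eq_bigr => a _; rewrite mul1r.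
- rewrite tr_adjmx // !adjmx_restr; apply/colP => i; rewrite !mxE.
  exact: eqn.
Qed.

End CliqueSplit.

(** * The expansions of the spectral radius *)

Section Expansions.
Variable F : realType.

(** [remainderJ K] bounds (N-1)^J times the error of the expansion truncated before
order J.  Truncating earlier adds the bounds of the dropped terms: K^4 for each of
the two terms of order 4, and K^3 for the term of order 3. *)
Definition remainder5 (K : F) := 5 * K ^+ 4 + 12 * K ^+ 5 + 20 * K ^+ 6.
Definition remainder4 (K : F) := remainder5 K + 2 * K ^+ 4.
Definition remainder3 (K : F) := remainder4 K + K ^+ 3.

(** The factors 8, 16 and 32 come from 1/(N-1) <= 2/N. *)
Lemma rho_expansions (K : F) N t (V : finType) (e : rel V) (C X : {set V})
    (R := adjmx F e C X) (A := adjmx F e X X) (b := R^T *m ones F C)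
    (P := 1%:M - N%:R^-1 *: (ones F C *m (ones F C)^T)) (n := N%:R : F)
    (r3 := n - 1 + dotv b b / (n * (n - 1)))
    (r4 := r3 + dotv b (A *m b) / (n * (n - 1) ^+ 2))
    (r5 := r4 + dotv b (A *m A *m b) / (n * (n - 1) ^+ 3)
             + dotv b (R^T *m P *m R *m b) / (n ^+ 2 * (n - 1) ^+ 2)) :
  admissible K N t e C X -> large_order K N ->
  [/\ `|rho F e - r3| <= 8 * remainder3 K / n ^+ 3,
      `|rho F e - r4| <= 16 * remainder4 K / n ^+ 4,
      `|rho F e - r5| <= 32 * remainder5 K / n ^+ 5
    & dotv b (R^T *m P *m R *m b) = norm2 (P *m R *m b) ^+ 2].
Proof.
move=> [split_e normK]; rewrite /large_order -/n => nM.
have [R_ge0 A_ge0 b_ge0] := And3 (opnorm_ge0 R) (opnorm_ge0 A) (norm2_ge0 b).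
have [Rk Ak bk] : [/\ opnorm R <= K, opnorm A <= K & norm2 b <= K].
  by move: normK; rewrite /degvec -/R -/A -/b; split; lra.
have M_ge1 : 1 <= Num.max K 1 by rewrite le_max lexx orbT.
have K_ge0 : 0 <= K := le_trans R_ge0 Rk.
have N_gt0 : (0 < N)%N by rewrite -(ltr0n F) -/n; lra.
have sym_e : symmetric e by case: split_e => -[] [].
have symA : A^T = A by exact: tr_adjmx.
have oo : dotv (ones F C) (ones F C) = n.
  rewrite ones_restr dotv_restr (eq_bigr (fun=> 1)) => [|a _]; last by rewrite mulr1.
  by rewrite sumr_const; have [_ _ _ ->] := split_e.
have [lam [u [x [ux_neq0 rhoE lam_ge eqC eqX]]]] := rho_clique_split F split_e N_gt0.
have lamM : 5 * Num.max K 1 + 1 <= `|lam| by rewrite -/n in lam_ge; lra.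
have [y [eqL eqy]] := secular_vector Rk Ak lamM ux_neq0 eqC eqX.
have PE : proj_off (ones F C) = P by rewrite /proj_off oo.
have := secular_expansion symA Rk Ak bk _ _ eqL eqy; rewrite oo PE -rhoE.
set h := (n - 1)^-1; rewrite -/b => /(_ nM); rewrite rhoE => /(_ lam_ge); rewrite -rhoE => main.
have o_neq0 : dotv (ones F C) (ones F C) != 0 by rewrite oo gt_eqF; lra.
have pi_sqr : dotv b (R^T *m P *m R *m b) = norm2 (P *m R *m b) ^+ 2.
  by rewrite -!mulmxA dotv_adjoint trmxK -PE norm2_proj_off.
have n_gt0 : 0 < n by lra.
have n1_gt0 : 0 < n - 1 by lra.
have [n_neq0 n1_neq0] : n != 0 /\ n - 1 != 0 by rewrite !gt_eqF.
have h_ge0 : 0 <= h by rewrite invr_ge0 ltW.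
have h_le1 : h <= 1 by rewrite invf_le1 //; lra.
have nV_ge0 : 0 <= n^-1 by rewrite invr_ge0 ltW.
have nV_le : n^-1 <= h by rewrite lef_pV2 ?posrE //; lra.
have h_le : h <= 2 * n^-1.
  by rewrite -[leLHS]mul1r ler_pdivrMr // mulrAC ler_pdivlMr //; lra.
have norm_A c z : norm2 c <= z -> norm2 (A *m c) <= K * z.
  by move=> cx; apply: le_trans (norm2_mulmx _ _) (ler_pM _ _ _ _); rewrite ?opnorm_ge0 ?norm2_ge0.
have b_le c z : norm2 c <= z -> `|dotv b c| <= K * z.
  by move=> cx; apply: le_trans (cauchy_schwarz _ _) (ler_pM _ _ _ _); rewrite ?norm2_ge0.
have alpha_le := b_le _ _ (norm_A _ _ bk).
have gamma_le := b_le _ _ (norm_A _ _ (norm_A _ _ bk)).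
have pi_le : `|dotv b (R^T *m P *m R *m b)| <= K ^+ 4.
  rewrite pi_sqr ger0_norm ?sqr_ge0 // -PE -mulmxA norm2_proj_off // dotv_proj_off oo.
  have Rb_le : norm2 (R *m b) <= K * K.
    by apply: le_trans (norm2_mulmx _ _) (ler_pM _ _ _ _); rewrite ?norm2_ge0.
  have := ler_pM (norm2_ge0 _) (norm2_ge0 _) Rb_le Rb_le; rewrite -expr2 norm2_sqr.
  have := mulr_ge0 nV_ge0 (sqr_ge0 (dotv (ones F C) (R *m b))); lra.
have hn j l : (l <= j)%N -> h ^+ j <= h ^+ l by move=> lj; rewrite ler_wiXn2l.
have toN (c z : F) j : 0 <= c -> z <= c * h ^+ j -> z <= 2 ^+ j * c / n ^+ j.
  move=> c_ge0 /le_trans; apply; rewrite [2 ^+ j * c]mulrC -mulrA ler_wpM2l //.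
  by rewrite -exprVn -exprMn; apply: lerXn2r; rewrite ?nnegrE // mulr_ge0.
have Kpow j : 0 <= K ^+ j by rewrite exprn_ge0.
have rem5_ge0 : 0 <= remainder5 K by rewrite /remainder5 !addr_ge0 ?mulr_ge0.
have rem4_ge0 : 0 <= remainder4 K by rewrite /remainder4 addr_ge0 ?mulr_ge0.
have rem3_ge0 : 0 <= remainder3 K by rewrite /remainder3 addr_ge0.
have e5 : `|rho F e - r5| <= remainder5 K * h ^+ 5.
  rewrite [X in `|X|](_ : _ = rho F e - (n - 1)
     - (dotv b b * (h * n^-1) + dotv b (A *m b) * (h ^+ 2 * n^-1)
       + dotv b (A *m A *m b) * (h ^+ 3 * n^-1)
       + dotv b (R^T *m P *m R *m b) * (h ^+ 2 * n^-1 ^+ 2))) //.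
  by rewrite /r5 /r4 /r3 /h; field; rewrite n_neq0 n1_neq0.
have abs_h : `|h| <= h by rewrite ger0_norm.
have abs_nV : `|n^-1| <= h by rewrite ger0_norm.
have e4 : `|rho F e - r4| <= remainder4 K * h ^+ 4.
  rewrite [X in `|X|](_ : _ = rho F e - r5 + (dotv b (A *m (A *m b)) * (h * (h * h) * n^-1)
       + dotv b (R^T *m P *m R *m b) * (h * h * (n^-1 * n^-1)))); last first.
    by rewrite mulmxA /r5 /h; field; rewrite n_neq0 n1_neq0.
  have g1 := normM_le gamma_le (normM_le (normM_le abs_h (normM_le abs_h abs_h)) abs_nV).
  have g2 := normM_le pi_le (normM_le (normM_le abs_h abs_h) (normM_le abs_nV abs_nV)).
  apply: le_trans (normD_le e5 (normD_le g1 g2)) _.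
  have := ler_wpM2l rem5_ge0 (hn 5 4 isT); rewrite /remainder4; lra.
have e3 : `|rho F e - r3| <= remainder3 K * h ^+ 3.
  rewrite [X in `|X|](_ : _ = rho F e - r4 + dotv b (A *m b) * (h * h * n^-1)); last first.
    by rewrite /r4 /h; field; rewrite n_neq0 n1_neq0.
  have g1 := normM_le alpha_le (normM_le (normM_le abs_h abs_h) abs_nV).
  apply: le_trans (normD_le e4 g1) _.
  have := ler_wpM2l rem4_ge0 (hn 4 3 isT); rewrite /remainder3; lra.
split=> //.
- by have := toN _ _ 3 rem3_ge0 e3; rewrite (_ : 2 ^+ 3 = 8) //; ring.
- by have := toN _ _ 4 rem4_ge0 e4; rewrite (_ : 2 ^+ 4 = 16) //; ring.
- by have := toN _ _ 5 rem5_ge0 e5; rewrite (_ : 2 ^+ 5 = 32) //; ring.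
Qed.

End Expansions.

(** * Cliques with attached vertices *)

Section Pendants.
Variables (F : realType) (N t : nat).
Implicit Types (r : 'I_N -> 'I_t -> bool).

Definition attach r (a c : 'I_N + 'I_t) : bool :=
  match a, c with
  | inl i, inl i' => i != i'
  | inl i, inr j | inr j, inl i => r i j
  | inr _, inr _ => false
  end.

Definition clique_part : {set 'I_N + 'I_t} := inl @: [set: 'I_N].
Definition outer_part : {set 'I_N + 'I_t} := inr @: [set: 'I_t].

Lemma sum_clique_part (f : 'I_N + 'I_t -> F) :
  \sum_(a in clique_part) f a = \sum_i f (inl i).
Proof.
rewrite big_imset => [|i j _ _ []] //=.
by apply: eq_bigl => i; rewrite inE.
Qed.

Lemma sum_outer_part (f : 'I_N + 'I_t -> F) :
  \sum_(a in outer_part) f a = \sum_j f (inr j).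
Proof.
rewrite big_imset => [|i j _ _ []] //=.
by apply: eq_bigl => i; rewrite inE.
Qed.

Lemma attach_split r : (0 < N)%N -> (forall j, exists i, r i j) ->
  clique_split (attach r) clique_part outer_part N t.
Proof.
move=> N_gt0 r_cover.
have sym_r : symmetric (attach r) by move=> [i|j] [i'|j'] //=; rewrite eq_sym.
(* Every vertex is reached from the first clique vertex. *)
have to_hub a : connect (attach r) (inl (Ordinal N_gt0)) a.
  have hub i : connect (attach r) (inl (Ordinal N_gt0)) (inl i).
    by have [->|ne] := eqVneq (Ordinal N_gt0) i; [exact: connect0 | exact: connect1].
  case: a => [//|j]; have [i rij] := r_cover j.
  by apply: connect_trans (hub i) (connect1 _).
split.
- split; first by split=> // -[i|j] //=; rewrite eqxx.
  move=> a c; apply: connect_trans (to_hub c).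
  by rewrite (sym_connect_sym sym_r).
- split.
    apply/finset.setP => -[i|j]; rewrite !inE; first by rewrite imset_f ?inE.
    by rewrite orbC imset_f ?inE.
  by apply/pred0P => a /=; apply/andP => -[/imsetP[i _ ->] /imsetP[j _]].
- by move=> _ _ /imsetP[i _ ->] /imsetP[j _ ->] /=; apply: contraNneq => ->.
- by rewrite card_imset => [|i j []] //; rewrite cardsT card_ord.
- by rewrite card_imset => [|i j []] //; rewrite cardsT card_ord.
Qed.

Lemma attach_outer r : adjmx F (attach r) outer_part outer_part = 0.
Proof.
apply/matrixP => i j; rewrite !mxE.
by have /imsetP[a _ ->] := enum_valP i; have /imsetP[c _ ->] := enum_valP j.
Qed.

(** A weighting of the outer vertices, extended by 0 in order to be a weighting of all
vertices. *)
Definition outer_weight (d : 'I_t -> F) (a : 'I_N + 'I_t) : F := if a is inr j then d j else 0.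

Lemma degvec_attach r d : (forall j, \sum_i (r i j)%:R = d j) ->
  degvec F (attach r) clique_part outer_part = restr outer_part (outer_weight d).
Proof.
move=> rd; rewrite /degvec ones_restr tr_adjmx; last first.
  by move=> [i|j] [i'|j'] //=; rewrite eq_sym.
rewrite adjmx_restr; apply/colP => i; rewrite !mxE sum_clique_part.
have /imsetP[j _ ->] := enum_valP i; rewrite /= -rd.
by apply: eq_bigr => k _; rewrite mulr1.
Qed.

Lemma dotv_outer d : dotv (restr outer_part (outer_weight d)) (restr outer_part (outer_weight d))
  = \sum_j d j ^+ 2.
Proof. by rewrite dotv_restr sum_outer_part; apply: eq_bigr => j _; rewrite expr2. Qed.

(** With at most two clique neighbours for each outer vertex, R has at most 2t
entries 1 and each entry of b is at most 2, whence a bound uniform in N. *)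
Lemma attach_admissible r : (0 < N)%N -> (forall j, exists i, r i j) ->
  (forall j, \sum_i (r i j)%:R <= 2 :> F) ->
  admissible (Num.sqrt (2 * t%:R) + Num.sqrt (4 * t%:R) : F) N t (attach r) clique_part outer_part.
Proof.
move=> N_gt0 r_cover r_le2; split; first exact: attach_split.
rewrite attach_outer (degvec_attach (fun=> erefl)).
have A0 : opnorm (0 : 'M[F]_(#|outer_part|)) <= 0.
  apply: le_trans (opnorm_le_frob _) _.
  by rewrite /frob big1 ?sqrtr0 // => i _; rewrite big1 // => j _; rewrite mxE expr0n.
rewrite -[X in _ <= X + _]addr0; apply: lerD; first apply: lerD => //.
  apply: le_trans (opnorm_le_frob _) _; rewrite /frob ler_wsqrtr //.
  under eq_bigr => i _ do under eq_bigr => j _ do rewrite mxE.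
  rewrite -(big_enum_val (fun a => \sum_j (attach r a (enum_val j))%:R ^+ 2)) /=.
  under eq_bigr => a _ do rewrite -(big_enum_val (fun c => (attach r a c)%:R ^+ 2)) sum_outer_part.
  rewrite sum_clique_part exchange_big /=.
  rewrite mulr_natr -[X in _ *+ X]card_ord -sumr_const; apply: ler_sum => j _.
  apply: le_trans (r_le2 j); apply: ler_sum => i _.
  by case: (r i j); rewrite ?expr1n ?expr0n.
rewrite /norm2 ler_wsqrtr //; under eq_bigr do rewrite expr2.
rewrite -dotvE dotv_outer mulr_natr -[X in _ *+ X]card_ord -sumr_const; apply: ler_sum => j _.
have -> : 4 = 2 ^+ 2 :> F by ring.
by apply: lerXn2r; rewrite ?nnegrE // sumr_ge0.
Qed.

End Pendants.

Section Witnesses.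
Variables (F : realType) (N t : nat).
Implicit Types (r : 'I_N -> 'I_t -> bool).
Local Notation C := (clique_part N t).
Local Notation X := (outer_part N t).

Lemma placement_attach r d : (forall j, \sum_i (r i j)%:R = d j) ->
  placement F (attach r) C X =
    \sum_i (\sum_j (r i j)%:R * d j) ^+ 2 - N%:R^-1 * (\sum_j d j ^+ 2) ^+ 2.
Proof.
move=> rd; rewrite /placement.
have oo : dotv (ones F C) (ones F C) = #|C|%:R.
  rewrite ones_restr dotv_restr (eq_bigr (fun=> 1)) => [|a _]; last by rewrite mulr1.
  by rewrite sumr_const.
have -> : projC F C = proj_off (ones F C) by rewrite /proj_off oo.
rewrite -!mulmxA dotv_adjoint trmxK dotv_proj_off.
have -> : dotv (ones F C) (adjmx F (attach r) C X *m degvec F (attach r) C X)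
    = dotv (degvec F (attach r) C X) (degvec F (attach r) C X) by exact: dotv_adjoint.
rewrite (degvec_attach rd) adjmx_restr dotv_outer oo.
rewrite dotv_restr sum_clique_part (_ : #|C| = N); last first.
  by rewrite card_imset => [|i j []] //; rewrite cardsT card_ord.
congr (_ - _); apply: eq_bigr => i _; rewrite -expr2; congr (_ ^+ 2).
by rewrite sum_outer_part.
Qed.

Lemma sum_eq_ord n (c : 'I_n) : \sum_i (i == c)%:R = 1 :> F.
Proof.
by rewrite (bigD1 c) //= eqxx big1 ?addr0 // => i /negPf ->.
Qed.

(** The two sides are |R b|^2 for t vertices attached to the same clique vertex, and
after moving one of them elsewhere: t^2 against (t-1)^2 + 1. *)
Lemma two_attachments (c0 c1 : 'I_N) (j0 : 'I_t) : c0 != c1 -> (2 <= t)%N ->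
  \sum_i (\sum_(j < t) (i == c0)%:R * 1) ^+ 2
  <> \sum_i (\sum_(j < t) (i == if j == j0 then c1 else c0)%:R * 1) ^+ 2 :> F.
Proof.
move=> c01 t_ge2.
rewrite (bigD1 c0) //= [X in _ + X]big1 => [|i /negPf i0]; last first.
  by rewrite big1 ?expr0n // => j _; rewrite i0 mul0r.
rewrite [in RHS](bigD1 c1) //= [in RHS](bigD1 c0) //=.
rewrite [X in _ <> _ + (_ + X)]big1 => [|i /andP[/negPf i1 /negPf i0]]; last first.
  by rewrite big1 ?expr0n // => j _; case: ifP; rewrite ?i0 ?i1 mul0r.
have -> : \sum_(j < t) (c0 == c0)%:R * 1 = t%:R :> F.
  by rewrite eqxx mulr1 sumr_const card_ord.
have -> : \sum_(j < t) (c1 == if j == j0 then c1 else c0)%:R * 1 = 1 :> F.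
  rewrite -[RHS](sum_eq_ord j0); apply: eq_bigr => j _.
  by rewrite mulr1; case: ifP; rewrite ?eqxx // (eq_sym c1) (negPf c01).
have -> : \sum_(j < t) (c0 == if j == j0 then c1 else c0)%:R * 1 = t%:R - 1 :> F.
  have -> : t%:R = \sum_(j < t) 1 :> F by rewrite sumr_const card_ord.
  rewrite -[X in _ = _ - X](sum_eq_ord j0) -sumrB; apply: eq_bigr => j _.
  by rewrite mulr1; case: ifP; rewrite ?eqxx ?(negPf c01) ?subrr ?subr0.
have t_ge2' : 2 <= t%:R :> F by rewrite ler_nat.
move=> h; have : 2 * t%:R = 2 :> F by move: h; rewrite !addr0; lra.
lra.
Qed.

End Witnesses.

(** All outer vertices are attached to c0; in the second graph one of them is adjacent
to c1 as well, which raises its entry in b from 1 to 2. *)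
Lemma dotv_degvec_depends (F : realType) (t N : nat) : (1 <= t)%N -> (2 <= N)%N ->
  exists (V : finType) (e e' : rel V) (C X : {set V}),
    [/\ admissible (Num.sqrt (2 * t%:R) + Num.sqrt (4 * t%:R) : F) N t e C X,
        admissible (Num.sqrt (2 * t%:R) + Num.sqrt (4 * t%:R) : F) N t e' C X
      & dotv (degvec F e C X) (degvec F e C X) <> dotv (degvec F e' C X) (degvec F e' C X)].
Proof.
move=> t_gt0 N_ge2; pose c0 := Ordinal (ltnW N_ge2); pose c1 := Ordinal N_ge2.
pose j0 := Ordinal t_gt0.
pose r (i : 'I_N) (j : 'I_t) := i == c0.
pose r' (i : 'I_N) (j : 'I_t) := (i == c0) || (i == c1) && (j == j0).
have rd j : \sum_i (r i j)%:R = 1 :> F by exact: sum_eq_ord.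
have rd' j : \sum_i (r' i j)%:R = 1 + (j == j0)%:R :> F.
  have -> : 1 + (j == j0)%:R = \sum_i (i == c0)%:R + \sum_i (i == c1)%:R * (j == j0)%:R :> F.
    by rewrite -mulr_suml !sum_eq_ord mul1r.
  rewrite -big_split /=; apply: eq_bigr => i _; rewrite /r' -natrM mulnb.
  by have [->|_] /= := eqVneq i c0; rewrite ?addr0 ?add0r.
exists ('I_N + 'I_t)%type, (attach r), (attach r'), (clique_part N t), (outer_part N t); split.
- apply: attach_admissible => [|j|j]; first exact: ltnW.
    by exists c0; exact: eqxx.
  by rewrite rd ler1n.
- apply: attach_admissible => [|j|j]; first exact: ltnW.
    by exists c0; rewrite /r' eqxx.
  have : (j == j0)%:R <= 1 :> F by rewrite lern1 leq_b1.
  rewrite rd'; lra.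
- rewrite (degvec_attach rd) (degvec_attach rd') !dotv_outer; apply/eqP; rewrite lt_eqF //.
  rewrite (bigD1 j0) //= [ltRHS](bigD1 j0) //= -[true%:R]/1; apply: ltr_leD; first by lra.
  by apply: ler_sum => j /negPf ->; rewrite addr0.
Qed.

(** All outer vertices are attached to c0; in the second graph one of them is attached
to c1 instead, which leaves b = 1 and A_X = 0 unchanged. *)
Lemma placement_depends (F : realType) (t N : nat) : (2 <= t)%N -> (2 <= N)%N ->
  exists (V : finType) (e e' : rel V) (C X : {set V}),
    [/\ admissible (Num.sqrt (2 * t%:R) + Num.sqrt (4 * t%:R) : F) N t e C X,
        admissible (Num.sqrt (2 * t%:R) + Num.sqrt (4 * t%:R) : F) N t e' C X,
        adjmx F e X X = adjmx F e' X X, degvec F e C X = degvec F e' C X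
      & placement F e C X <> placement F e' C X].
Proof.
move=> t_ge2 N_ge2; pose c0 := Ordinal (ltnW N_ge2); pose c1 := Ordinal N_ge2.
pose j0 := Ordinal (ltnW t_ge2).
pose r (i : 'I_N) (j : 'I_t) := i == c0.
pose r' (i : 'I_N) (j : 'I_t) := i == if j == j0 then c1 else c0.
have rd j : \sum_i (r i j)%:R = 1 :> F by exact: sum_eq_ord.
have rd' j : \sum_i (r' i j)%:R = 1 :> F by exact: sum_eq_ord.
exists ('I_N + 'I_t)%type, (attach r), (attach r'), (clique_part N t), (outer_part N t); split.
- apply: attach_admissible => [|j|j]; first exact: ltnW.
    by exists c0; exact: eqxx.
  by rewrite rd ler1n.
- apply: attach_admissible => [|j|j]; first exact: ltnW.
    by eexists; exact: eqxx.
  by rewrite rd' ler1n.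
- by rewrite !attach_outer.
- by rewrite (degvec_attach rd) (degvec_attach rd').
- rewrite (placement_attach rd) (placement_attach rd') => /addIr.
  exact: two_attachments.
Qed.

(** * Comparison of two graphs and conclusion *)

Lemma dist_sub_le (F : realType) (x x' c d d' z : F) :
  `|x - (c + d)| <= z -> `|x' - (c + d')| <= z -> `|x - x' - (d - d')| <= 2 * z.
Proof.
move=> hx hx'; have -> : x - x' - (d - d') = x - (c + d) - (x' - (c + d')) by ring.
by apply: le_trans (ler_normB _ _) _; rewrite mulr_natl mulr2n lerD.
Qed.

Lemma large_order_ge2 (F : realType) (K : F) N : large_order K N -> (2 <= N)%N.
Proof.
rewrite /large_order -(ler_nat F) => /(le_trans _); apply.
have : 1 <= Num.max K 1 by rewrite le_max lexx orbT.
lra.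
Qed.

Theorem lemma2p5 (F : realType) (t : nat) (ht : (1 <= t)%N) :
  (* the two expansions, with constants depending only on t and K *)
  (forall K : F, exists c4 c5 : F,
    forall (N : nat) (V : finType) (e : rel V) (C X : {set V}),
      admissible K N t e C X -> large_order K N ->
      let R := adjmx F e C X in
      let A := adjmx F e X X in
      let b := R^T *m ones F C in
      let P := 1%:M - N%:R^-1 *: (ones F C *m (ones F C)^T) in
      let n : F := N%:R in
      [/\ `| rho F e - (n - 1 + dotv b b / (n * (n - 1))
                        + dotv b (A *m b) / (n * (n - 1) ^+ 2)) |
            <= c4 / n ^+ 4,
          `| rho F e - (n - 1 + dotv b b / (n * (n - 1))
                        + dotv b (A *m b) / (n * (n - 1) ^+ 2)
                        + dotv b (A *m A *m b) / (n * (n - 1) ^+ 3)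
                        + dotv b (R^T *m P *m R *m b)
                          / (n ^+ 2 * (n - 1) ^+ 2)) |
            <= c5 / n ^+ 5
        & dotv b (R^T *m P *m R *m b) = norm2 (P *m R *m b) ^+ 2])
  /\
  (* two choices of (R, A_X) on the same C and X: the spectral radii differ
     first through b^T b and, when A_X and b agree, first through
     b^T R^T P_C R b *)
  (forall K : F, exists d3 d5 : F,
    forall (N : nat) (V : finType) (e e' : rel V) (C X : {set V}),
      admissible K N t e C X -> admissible K N t e' C X -> large_order K N ->
      let b := degvec F e C X in
      let b' := degvec F e' C X in
      let n : F := N%:R in
      `| (rho F e - rho F e')
         - (dotv b b - dotv b' b') / (n * (n - 1)) | <= d3 / n ^+ 3
      /\
      (adjmx F e X X = adjmx F e' X X -> b = b' ->
       `| (rho F e - rho F e')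
          - (placement F e C X - placement F e' C X)
            / (n ^+ 2 * (n - 1) ^+ 2) | <= d5 / n ^+ 5))
  /\
  (* these two quantities do depend on the choice; the second one only once
     X has at least two vertices *)
  (exists K : F, forall N : nat, large_order K N ->
    (exists (V : finType) (e e' : rel V) (C X : {set V}),
      [/\ admissible K N t e C X, admissible K N t e' C X
        & dotv (degvec F e C X) (degvec F e C X)
          <> dotv (degvec F e' C X) (degvec F e' C X)])
    /\
    ((2 <= t)%N -> exists (V : finType) (e e' : rel V) (C X : {set V}),
      [/\ admissible K N t e C X, admissible K N t e' C X,
          adjmx F e X X = adjmx F e' X X, degvec F e C X = degvec F e' C X
        & placement F e C X <> placement F e' C X])).
Proof.
split; [|split].
- move=> K; exists (16 * remainder4 K), (32 * remainder5 K) => N V e C X adm large R A b P n.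
  by have [_ b4 b5 b_pi] := rho_expansions adm large; split.
- move=> K; exists (16 * remainder3 K), (64 * remainder5 K).
  move=> N V e e' C X adm adm' large b b' n.
  have [b3 _ b5 _] := rho_expansions adm large.
  have [b3' _ b5' _] := rho_expansions adm' large.
  have placementE e1 : admissible K N t e1 C X -> placement F e1 C X = dotv (degvec F e1 C X)
      ((adjmx F e1 C X)^T *m (1%:M - n^-1 *: (ones F C *m (ones F C)^T)) *m adjmx F e1 C X
        *m degvec F e1 C X).
    by move=> [[_ _ _ cardC _] _]; rewrite /n /placement /projC -cardC.
  (* Once A_X and b agree, both expansions share all terms but the last one. *)
  rewrite -/(degvec F e C X) in b3 b5; rewrite -/(degvec F e' C X) in b3' b5'.
  rewrite -/n -(placementE e adm) in b5; rewrite -/n -(placementE e' adm') in b5'.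
  split=> [|eqA eqb].
    rewrite mulrBl (_ : 16 * remainder3 K / n ^+ 3 = 2 * (8 * remainder3 K / n ^+ 3)); last by ring.
    exact: dist_sub_le b3 b3'.
  rewrite mulrBl (_ : 64 * remainder5 K / n ^+ 5 = 2 * (32 * remainder5 K / n ^+ 5)); last by ring.
  rewrite -/b eqA eqb in b5.
  exact: dist_sub_le b5 b5'.
- exists (Num.sqrt (2 * t%:R) + Num.sqrt (4 * t%:R)) => N /large_order_ge2 N_ge2.
  by split=> [|t_ge2]; [exact: dotv_degvec_depends | exact: placement_depends].
Qed.
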